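(* Let $G$ be a median graph with basepoint $v_0$. Let $m\in V$ and let $L,L^*$ be two POFs outgoing from $m$. Let $u,v$ be vertices with $m\in I(v_0,u)$ and $m\in I(v_0,v)$ such that $L_{m,u}=L$ and $L_{m,v}=L^*$. Then $m\in I(u,v)$ if and only if $L\cap L^*=\emptyset$.
   Context: $G=(V,E)$ is a finite, simple, connected, undirected median graph: for all vertices $x,y,z$ the set $I(x,y)\cap I(y,z)\cap I(z,x)$ has exactly one element, where $I(u,v)=\{w: d(u,w)+d(w,v)=d(u,v)\}$. Edges $uv,xy$ are in relation $\Theta_0$ if $uvyx$ is a 4-cycle; $\Theta$ is the reflexive transitive closure of $\Theta_0$, with equivalence classes ($\Theta$-classes). For each class, removing its edges leaves exactly two connected components (halfspaces). Classes $E_i,E_j$ are orthogonal if there is a 4-cycle $uvyx$ with $uv,xy\in E_i$, $ux,vy\in E_j$; a POF is a set of classes any two distinct members of which are orthogonal. Each edge $xy$ is oriented from $x$ to $y$ when $d(v_0,x)<d(v_0,y)$; a POF $L$ is outgoing from $m$ if every class of $L$ has an edge oriented out of $m$. The signature $\sigma_{x,y}$ is the set of classes separating $x$ and $y$. For $x\in I(v_0,y)$, the ladder set $L_{x,y}$ is the set of classes in $\sigma_{x,y}$ having an edge incident to $x$. *)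

(* Defs.v *)
From mathcomp Require Import all_boot.

Set Implicit Arguments.
Unset Strict Implicit.
Unset Printing Implicit Defensive.

(* A finite graph is an adjacency relation [e] on a finType [T]. An undirected
   edge xy is the set [set x; y], and a set of edges, in particular a
   Theta-class, is a [{set {set T}}]. *)

(* The [#|T|] returned when no walk exists is never reached in a connected
   graph, where distances are less than [#|T|]. *)
Definition dist (T : finType) (e : rel T) (x y : T) : nat :=
  find (fun n => [exists p : n.-tuple T, path e x p && (last x p == y)])
       (iota 0 #|T|).

Definition interval (T : finType) (e : rel T) (u v : T) : {set T} :=
  [set w | dist e u w + dist e w v == dist e u v].

Definition median_graph (T : finType) (e : rel T) : Prop :=
  [/\ symmetric e,
      irreflexive e,
      forall x y, connect e x y
    & forall x y z,
        #|interval e x y :&: interval e y z :&: interval e z x| = 1].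

Definition edges (T : finType) (e : rel T) : {set {set T}} :=
  [set [set x; y] | x in T, y in T & e x y].

(* The cycle a b c d a, with four distinct vertices: distinctness of adjacent
   ones comes from irreflexivity of [e]. *)
Definition cycle4 (T : finType) (e : rel T) (a b c d : T) : bool :=
  [&& e a b, e b c, e c d, e d a, a != c & b != d].

Definition Theta0 (T : finType) (e : rel T) : rel {set T} :=
  fun A B => [exists u, exists v, exists x, exists y,
    [&& cycle4 e u v y x, A == [set u; v] & B == [set x; y]]].

Definition Theta (T : finType) (e : rel T) : rel {set T} :=
  connect (Theta0 e).

Definition Theta_classes (T : finType) (e : rel T) : {set {set {set T}}} :=
  equivalence_partition (Theta e) (edges e).

Definition orthogonal (T : finType) (e : rel T) (Ei Ej : {set {set T}}) : bool :=
  [exists u, exists v, exists x, exists y,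
    [&& cycle4 e u v y x,
        [set u; v] \in Ei, [set x; y] \in Ei,
        [set u; x] \in Ej & [set v; y] \in Ej]].

Definition is_POF (T : finType) (e : rel T) (L : {set {set {set T}}}) : Prop :=
  L \subset Theta_classes e /\
  {in L &, forall Ei Ej, Ei != Ej -> orthogonal e Ei Ej}.

Definition oriented (T : finType) (e : rel T) (v0 x y : T) : bool :=
  e x y && (dist e v0 x < dist e v0 y).

Definition outgoing (T : finType) (e : rel T) (v0 m : T)
    (L : {set {set {set T}}}) : Prop :=
  {in L, forall Ei : {set {set T}},
    exists2 y, oriented e v0 m y & [set m; y] \in Ei}.

Definition remove_edges (T : finType) (e : rel T) (E : {set {set T}}) : rel T :=
  fun x y => e x y && ([set x; y] \notin E).

(* The halfspaces of a class are the connected components left by its removal;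
   the class separates two vertices lying in different components. *)
Definition halfspaces (T : finType) (e : rel T) (E : {set {set T}}) :
    {set {set T}} :=
  equivalence_partition (connect (remove_edges e E)) [set: T].

Definition separates (T : finType) (e : rel T) (E : {set {set T}}) (x y : T) :
    bool :=
  [exists H1 in halfspaces e E, exists H2 in halfspaces e E,
    [&& H1 != H2, x \in H1 & y \in H2]].

Definition signature (T : finType) (e : rel T) (x y : T) : {set {set {set T}}} :=
  [set E in Theta_classes e | separates e E x y].

Definition ladder_set (T : finType) (e : rel T) (x y : T) :
    {set {set {set T}}} :=
  [set E in signature e x y | [exists A in E, x \in A]].

(* Main.v *)
Require Import Defs.
From mathcomp Require Import all_boot zify.

Set Implicit Arguments.
Unset Strict Implicit.
Unset Printing Implicit Defensive.

(* The Theta-class of an edge ab consists of the edges joining the sides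
   W_ab = {w | d(w,a) < d(w,b)} and W_ba, so it separates a from u exactly when
   d(b,u) < d(a,u).  If m is not in I(u,v), the median of m, u, v differs from
   m, and the first edge of a geodesic from m to it lies in a class of both
   ladder sets.  Conversely, a common class contains an edge my with y closer
   than m to both u and v, so that d(u,v) < d(u,m) + d(m,v). *)

(** * Walks, geodesics and the metric axioms for [dist] *)

Section Distance.

Variables (T : finType) (e : rel T).
Hypotheses (e_sym : symmetric e) (e_conn : forall x y, connect e x y).

Local Notation d := (dist e).

Lemma dist_path x p : path e x p -> d x (last x p) <= size p.
Proof.
move=> xp; rewrite leqNgt; apply/negP => lt_p.
have lt_pT : size p < #|T|.
  (* [find] returns at most the length [#|T|] of the list it scans, so [size p] is one of the
     lengths rejected before the result, although [p] itself has that length. *)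
  by apply: leq_trans lt_p _; rewrite -[X in _ <= X](size_iota 0) find_size.
have := before_find 0 lt_p; rewrite nth_iota //= add0n => /negbT/existsP[].
by exists (in_tuple p); rewrite /= xp eqxx.
Qed.

Lemma geodesicP x y :
  exists p, [/\ path e x p, last x p = y & size p = d x y].
Proof.
have /connectP[p0 p0_path ->] := e_conn x y.
(* A path without repeated vertices has length below [#|T|], so the search succeeds and the default
   value is not returned. *)
case: (shortenP p0_path) => p p_path p_uniq _.
pose P n := [exists q : n.-tuple T, path e x q && (last x q == last x p)].
have hasP : has P (iota 0 #|T|).
  apply/hasP; exists (size p).
    rewrite mem_iota /= add0n; apply: leq_trans (max_card (mem (x :: p))).
    by rewrite (card_uniqP p_uniq).
  by apply/existsP; exists (in_tuple p); rewrite /= p_path eqxx.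
have lt_dT : d x (last x p) < #|T|.
  by rewrite -[X in _ < X](size_iota 0) -has_find.
have := nth_find 0 hasP; rewrite nth_iota // add0n => /existsP[q].
case/andP=> q_path /eqP; by exists q; rewrite size_tuple.
Qed.

Lemma dist_refl x : d x x = 0.
Proof. by apply/eqP; rewrite -leqn0; apply: (@dist_path x [::]). Qed.

Lemma dist_eq0 x y : d x y = 0 -> x = y.
Proof. by have [[|z p] [_ <- <-]] := geodesicP x y. Qed.

Lemma dist_triangle y x z : d x z <= d x y + d y z.
Proof.
have [p [p_path py <-]] := geodesicP x y.
have [q [q_path <- <-]] := geodesicP y z.
by rewrite -py -last_cat -size_cat dist_path // cat_path p_path py.
Qed.

Lemma dist_sym x y : d x y = d y x.
Proof.
have le_d a b : d a b <= d b a.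
  have [p [p_path <- <-]] := geodesicP b a.
  have := @dist_path (last b p) (rev (belast b p)).
  rewrite rev_path (eq_path (e' := e)) // size_rev size_belast => /(_ p_path).
  by case: p {p_path} => //= z p; rewrite rev_cons last_rcons.
by apply/eqP; rewrite eqn_leq !le_d.
Qed.

Lemma dist_edge_le1 x y : e x y -> d x y <= 1.
Proof. by move=> xy; apply: (@dist_path x [:: y]); rewrite /= xy. Qed.

Lemma dist1_edge x y : d x y = 1 -> e x y.
Proof.
have [p [+ <- <-]] := geodesicP x y.
by case: p => [|z [|? ?]] //= /andP[].
Qed.

Lemma geodesic_step x y : x != y -> exists2 z, e x z & d x y = (d z y).+1.
Proof.
have [[|z p] [/= xp lp sp]] := geodesicP x y; first by rewrite lp eqxx.
case/andP: xp => xz zp _; exists z => //.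
have := dist_path zp; have := dist_triangle z x y; have := dist_edge_le1 xz.
by rewrite lp -sp; lia.
Qed.

End Distance.

Section MedianGraph.

Variables (T : finType) (e : rel T).
Hypothesis hG : median_graph e.

Local Notation d := (dist e).

Let e_sym : symmetric e. Proof. by case: hG. Qed.
Let e_irr : irreflexive e. Proof. by case: hG. Qed.
Let e_conn x y : connect e x y. Proof. by case: hG => _ _ + _; apply. Qed.
Let d_sym := dist_sym e_sym e_conn.
Let d_tri := dist_triangle e_conn.

(** * Medians, bipartiteness and the quadrangle property *)

Lemma median_exists x y z : exists w,
  [/\ d x w + d w y = d x y, d y w + d w z = d y z & d x w + d w z = d x z].
Proof.
case: hG => _ _ _ /(_ x y z) /eqP/cards1P[w Ew].
have : w \in [set w] by rewrite inE.
rewrite -Ew !inE => /andP[/andP[/eqP xy /eqP yz] /eqP zx].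
by exists w; rewrite xy yz addnC (d_sym w z) (d_sym x w) zx d_sym.
Qed.

Lemma median_unique x y z w w' :
    d x w + d w y = d x y -> d y w + d w z = d y z -> d x w + d w z = d x z ->
    d x w' + d w' y = d x y -> d y w' + d w' z = d y z ->
    d x w' + d w' z = d x z ->
  w = w'.
Proof.
case: hG => _ _ _ /(_ x y z) /eqP/cards1P[t Et].
move=> h1 h2 h3 k1 k2 k3.
suff mem_t s : d x s + d s y = d x y -> d y s + d s z = d y z ->
    d x s + d s z = d x z -> s = t.
  by rewrite (mem_t w) // (mem_t w').
move=> s1 s2 s3; apply/set1P; rewrite -Et !inE s1 s2 !eqxx /=.
by rewrite (d_sym z s) (d_sym s x) (d_sym z x) addnC s3.
Qed.

Lemma dist_edge x y : e x y -> d x y = 1.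
Proof.
move=> xy; have := dist_edge_le1 xy; case E: (d x y) => [|[|//]] // _.
by move: xy; rewrite (dist_eq0 e_conn E) e_irr.
Qed.

(** The median of [x], [y], [z] lies between the adjacent vertices [x] and [y], so it is one of
    them, and that one lies on a geodesic from the other to [z]. *)
Lemma dist_edge_bipartite x y z :
  e x y -> d x z = (d y z).+1 \/ d y z = (d x z).+1.
Proof.
move=> xy; have [w [h1 h2 h3]] := median_exists x y z.
have xy1 := dist_edge xy; rewrite xy1 in h1.
case xw : (d x w) => [|k].
  right; rewrite (dist_eq0 e_conn xw) in h2 *.
  by rewrite -h2 -(dist_eq0 e_conn xw) (d_sym y x) xy1.
have wy : w = y by apply: (dist_eq0 e_conn); lia.
by left; rewrite -h3 wy xy1.
Qed.

Lemma dist_common_neighbour x y z : e z x -> e z y -> x != y -> d x y = 2.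
Proof.
move=> zx zy xy; have := dist_edge_bipartite y zx; rewrite (dist_edge zy).
case=> [[] /esym/(dist_eq0 e_conn)/esym E|//]; last first.
by rewrite -E eqxx in xy.
Qed.

(** Take the median of [x], [y], [z]: as [d x y = 2] and [x], [y] are equidistant from [z], it is
    adjacent to both. *)
Lemma quadrangle p x y z : e p x -> e p y -> x != y ->
    d p z = (d x z).+1 -> d p z = (d y z).+1 ->
  exists w, [/\ e x w, e y w & d x z = (d w z).+1].
Proof.
move=> px py xy pxz pyz; have xy2 := dist_common_neighbour px py xy.
have [w [h1 h2 h3]] := median_exists x y z.
have wy := d_sym w y.
by exists w; split; [apply: (dist1_edge e_conn) ..|]; lia.
Qed.

(* The closer side of ab is convex; this is the local form of that fact. *)
Lemma side_locally_convex a b u v x : e a b -> e u v -> e u x -> v != x ->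
    d u a < d u b -> d v b < d v a -> d x a < d x b.
Proof.
move=> ab uv ux vx su sv; rewrite ltnNge; apply/negP => sx.
have [ba1 ab1] : d b a = 1 /\ d a b = 1.
  by rewrite !dist_edge // e_sym.
have := (dist_edge_bipartite a uv, dist_edge_bipartite b uv,
         dist_edge_bipartite a ux, dist_edge_bipartite b ux).
have := (dist_edge_bipartite u ab, dist_edge_bipartite v ab,
         dist_edge_bipartite x ab).
rewrite !(d_sym a) !(d_sym b) => -[[bu bv] bx] [[[uva uvb] uxa] uxb].
(* If [x] were on the side of [b], then both [v] and [x] would be one step nearer to [b] than [u]
   is. *)
have [w [vw xw vb]] := @quadrangle u v x b uv ux vx ltac:(lia) ltac:(lia).
have := (dist_edge_bipartite a vw, d_tri b w a) => -[vwa wa].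
have vx2 := dist_common_neighbour uv ux vx.
have [vu1 ux1 xu1] : [/\ d v u = 1, d u x = 1 & d x u = 1].
  by split; apply: dist_edge; rewrite // e_sym.
have [vw1 wx1 xw1] : [/\ d v w = 1, d w x = 1 & d x w = 1].
  by split; apply: dist_edge; rewrite // e_sym.
(* Both [u] and [w] are adjacent to [v] and [x] and one step nearer to [a], hence both are medians
   of [v], [x], [a]. Yet [w] is nearer to [b] than [u] is. *)
have uw : u = w by apply: (@median_unique v x a); lia.
by rewrite -uw in vb; lia.
Qed.

(** * Theta-classes as cuts between the two sides of an edge *)

Definition crossing a b (A : {set T}) :=
  exists p q, [/\ e p q, A = [set p; q], d p a < d p b & d q b < d q a].

(** In the square, local convexity at each end of the crossing edge keeps the other neighbour of
    that end on the same side, so the opposite edge crosses too. *)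
Lemma crossing_Theta0 a b A B :
  e a b -> Theta0 e A B -> crossing a b A -> crossing a b B.
Proof.
move=> ab /existsP[u /existsP[v /existsP[x /existsP[y]]]].
case/and3P=> /and5P[uv vy yx xu /andP[uy vx]] /eqP-> /eqP->.
move=> [p [q [pq Apq sp sq]]].
have ba : e b a by rewrite e_sym.
have ux : e u x by rewrite e_sym.
have vu : e v u by rewrite e_sym.
have xy : e x y by rewrite e_sym.
have : p \in [set u; v] by rewrite Apq !inE eqxx.
have : q \in [set u; v] by rewrite Apq !inE eqxx orbT.
rewrite !inE => /orP[]/eqP Eq /orP[]/eqP Ep; subst p q.
- by rewrite e_irr in pq.
- exists y, x; split=> //; first by rewrite setUC.
    by apply: (side_locally_convex ab vu vy).
  by apply: (side_locally_convex ba uv ux).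
- exists x, y; split=> //.
    by apply: (side_locally_convex ab uv ux).
  by apply: (side_locally_convex ba vu vy).
- by rewrite e_irr in pq.
Qed.

Lemma Theta_crossing a b B : e a b -> Theta e [set a; b] B -> crossing a b B.
Proof.
move=> ab /connectP[s + ->].
have : crossing a b [set a; b].
  have ba : e b a by rewrite e_sym.
  by exists a, b; rewrite !(dist_refl e) !dist_edge.
elim: s [set a; b] => //= C s IH A crA /andP[AC Cs].
by apply: IH Cs; apply: crossing_Theta0 crA.
Qed.

Lemma Theta0_sym : symmetric (Theta0 e).
Proof.
suff imp A B : Theta0 e A B -> Theta0 e B A.
  by move=> A B; apply/idP/idP; apply: imp.
move=> /existsP[u /existsP[v /existsP[x /existsP[y]]]].
case/and3P=> /and5P[uv vy yx xu /andP[uy vx]] EA EB.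
apply/existsP; exists x; apply/existsP; exists y.
apply/existsP; exists u; apply/existsP; exists v.
by rewrite EA EB /cycle4 [e x y]e_sym [e y v]e_sym [e v u]e_sym [e u x]e_sym
  yx vy uv xu eq_sym vx eq_sym uy.
Qed.

Lemma Theta_equiv : equivalence_rel (Theta e).
Proof.
by apply/equivalence_relP; split; [apply: connect0 |
  apply: same_connect; apply: sym_connect_sym; apply: Theta0_sym].
Qed.

(** Induction on [d p a]: the quadrangle property slides [pq] across a square to a crossing edge one
    step nearer to [ab]. When [p = a], the inequality on [q] forces [q = b]. *)
Lemma crossing_edge_Theta a b p q :
  e a b -> e p q -> d p a < d p b -> d q b < d q a ->
  Theta e [set a; b] [set p; q].
Proof.
move=> ab; have [ba1 ab1] : d b a = 1 /\ d a b = 1 by rewrite !dist_edge // e_sym.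
elim: {p}(d p a) {-2}p (erefl (d p a)) q => [|k IH] p pa q pq sp sq.
  move: (pq); rewrite (dist_eq0 e_conn pa) => /dist_edge aq.
  rewrite (d_sym q a) aq in sq.
  have /(dist_eq0 e_conn)-> : d q b = 0 by lia.
  exact: connect0.
have pna : p != a by apply/eqP => E; rewrite E dist_refl in pa.
have [p' pp' pa'] := geodesic_step e_conn pna.
have := (dist_edge_bipartite a pq, dist_edge_bipartite b pq,
         dist_edge_bipartite b pp').
have := (dist_edge_bipartite p ab, dist_edge_bipartite q ab,
         dist_edge_bipartite p' ab).
rewrite !(d_sym a) !(d_sym b) => -[[bp bq] bp'] [[pqa pqb] ppb].
have p'q : p' != q by apply/eqP => E; rewrite E in pa'; lia.
(* Both [p'] and [q] are one step nearer to [b] than [p]; the new vertex [q'] completes the square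
   and lies on the side of [b]. *)
have [q' [p'q' qq' q'b]] :=
  @quadrangle p p' q b pp' pq p'q ltac:(lia) ltac:(lia).
have := (dist_edge_bipartite a qq', d_tri b q' a) => -[qq'a q'a].
apply: (connect_trans (IH p' _ q' p'q' _ _)); try lia.
apply: connect1; rewrite Theta0_sym.
apply/existsP; exists p; apply/existsP; exists q.
apply/existsP; exists p'; apply/existsP; exists q'.
rewrite !eqxx /cycle4 pq qq' [e q' p']e_sym p'q' [e p' p]e_sym pp' /=.
rewrite andbT [q == _]eq_sym p'q andbT.
by apply/eqP => E; rewrite -E in q'b; lia.
Qed.

(** Written exactly as the blocks of [equivalence_partition], so that for an edge [A] it is a member
    of [Theta_classes] by unfolding. *)
Definition Theta_class (A : {set T}) := [set B in edges e | Theta e A B].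

Lemma edgesP A : reflect (exists x y, e x y /\ A = [set x; y]) (A \in edges e).
Proof.
apply: (iffP imset2P) => [[x y _]|[x [y [xy ->]]]].
  by rewrite inE => /andP[_ xy] ->; exists x, y.
by exists x y; rewrite ?inE.
Qed.

(** Both directions of the cut description together: chains of squares are replaced by a distance
    test. *)
Lemma mem_Theta_class a b p q : e a b -> e p q ->
  d p a < d p b -> ([set p; q] \in Theta_class [set a; b]) = (d q b < d q a).
Proof.
move=> ab pq sp; apply/idP/idP => [|sq]; last first.
  rewrite inE crossing_edge_Theta // andbT.
  by apply/edgesP; exists p, q.
rewrite inE => /andP[_ /(Theta_crossing ab)[x [y [xy E sx sy]]]].
have : y \in [set p; q] by rewrite E !inE eqxx orbT.
(* [y] lies on the side of [b] and [p] does not, so [y] must be [q]. *)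
by rewrite !inE => /orP[]/eqP Ey; rewrite -Ey in sp *; lia.
Qed.

(** * Halfspaces and separation *)

Lemma remove_edges_sym E : symmetric (remove_edges e E).
Proof. by move=> x y; rewrite /remove_edges e_sym setUC. Qed.

(** A remaining edge never changes side. Conversely, a geodesic to [a] from a vertex on the side of
    [a] stays on that side, so it uses no removed edge. *)
Lemma connect_remove_Theta_class a b u : e a b ->
  connect (remove_edges e (Theta_class [set a; b])) a u = (d u a < d u b).
Proof.
move=> ab; set R := remove_edges e _.
have Rsym : symmetric R by apply: remove_edges_sym.
apply/idP/idP => [/connectP[s a_s ->]|].
  suff stay p : path R p s -> d p a < d p b -> d (last p s) a < d (last p s) b.
    by apply: stay; rewrite // dist_refl dist_edge.
  elim: s p {a_s} => //= q s IH p /andP[/andP[pq]] + qs sp.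
  rewrite mem_Theta_class // -leqNgt => sq; apply: IH => //.
  by have := dist_edge_bipartite q ab; rewrite !(d_sym _ q); lia.
elim: {u}(d u a) {-2}u (erefl (d u a)) => [|k IH] u ua su.
  by rewrite (dist_eq0 e_conn ua) connect0.
have una : u != a by apply/eqP => E; rewrite E dist_refl in ua.
have [w uw wa] := geodesic_step e_conn una.
have sw : d w a < d w b by have := dist_edge_bipartite b uw; lia.
apply: (connect_trans (IH w _ sw)); first lia.
apply: connect1; rewrite Rsym /R /remove_edges uw mem_Theta_class //.
by rewrite -leqNgt ltnW.
Qed.

(** The components partition the vertices, so [H1] and [H2] can only be the blocks of [x] and [y],
    which differ exactly when no remaining path joins them. *)
Lemma separatesE E x y : separates e E x y = ~~ connect (remove_edges e E) x y.
Proof.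
set R := remove_edges e E.
have Req : equivalence_rel (connect R).
  by apply/equivalence_relP; split; [apply: connect0 |
    apply: same_connect; apply: sym_connect_sym; apply: remove_edges_sym].
have Req' : {in [set: T] & &, equivalence_rel (connect R)}.
  by move=> ? ? ? _ _ _; apply: Req.
have /and3P[/eqP covT triv _] := equivalence_partitionP Req'.
apply/existsP/idP => [[H1 /andP[H1P /existsP[H2 /and4P[H2P H12 xH1 yH2]]]]|nxy].
  rewrite -(pblock_equivalence_partition Req') ?inE //.
  rewrite (def_pblock triv H1P xH1); apply: contra H12 => yH1.
  by rewrite -(def_pblock triv H1P yH1) (def_pblock triv H2P yH2).
have in_cov z : z \in cover (equivalence_partition (connect R) [set: T]).
  by rewrite covT inE.
exists (pblock (equivalence_partition (connect R) [set: T]) x).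
rewrite pblock_mem //=; apply/existsP.
exists (pblock (equivalence_partition (connect R) [set: T]) y).
rewrite pblock_mem //= !mem_pblock !in_cov !andbT.
by rewrite eq_pblock // pblock_equivalence_partition ?inE.
Qed.

Lemma separates_Theta_class a b u : e a b ->
  separates e (Theta_class [set a; b]) a u = (d b u < d a u).
Proof.
move=> ab; rewrite separatesE connect_remove_Theta_class //.
(* By bipartiteness [u] is never equidistant from [a] and [b]. *)
by have := dist_edge_bipartite u ab; rewrite !(d_sym u); lia.
Qed.

(** * Ladder sets in terms of distances *)

Lemma Theta_class_mem A : A \in edges e -> Theta_class A \in Theta_classes e.
Proof. by move=> Ae; apply: imset_f. Qed.

Lemma Theta_classes_eq E A : E \in Theta_classes e -> A \in E ->
  A \in edges e /\ E = Theta_class A.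
Proof.
move=> /imsetP[B Be ->]; rewrite inE => /andP[Ae BA]; split=> //.
apply/setP => C; rewrite !inE.
by rewrite (Theta_equiv B A C).2.
Qed.

(** Every edge of a class represents it, so the one incident to [m] can be chosen. *)
Lemma ladder_set_edge m u E : E \in ladder_set e m u ->
  exists2 y, e m y & E = Theta_class [set m; y].
Proof.
rewrite !inE => /andP[/andP[Ecl _] /existsP[A /andP[AE mA]]].
have [/edgesP[p [q [pq EA]]] ->] := Theta_classes_eq Ecl AE.
move: mA; rewrite EA !inE => /orP[]/eqP->; first by exists q.
by exists p; [rewrite e_sym | rewrite setUC].
Qed.

(** The edge [my] itself witnesses incidence to [m], which leaves only the separation of [m] from
    [u]. *)
Lemma mem_ladder_set m y u : e m y ->
  (Theta_class [set m; y] \in ladder_set e m u) = (d y u < d m u).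
Proof.
move=> my; have mye : [set m; y] \in edges e by apply/edgesP; exists m, y.
rewrite !inE Theta_class_mem // separates_Theta_class //.
apply: andb_idr => _; apply/existsP; exists [set m; y].
by rewrite inE mye set21 andbT; apply: connect0.
Qed.

Lemma mem_interval_ladder m u v :
  m \in interval e u v <-> ladder_set e m u :&: ladder_set e m v = set0.
Proof.
split=> [|disj].
  rewrite inE => /eqP muv; apply/setP => E; rewrite in_set0.
  apply/negbTE; rewrite inE; apply/negP => /andP[Eu].
  have [y my EE] := ladder_set_edge Eu.
  move: Eu; rewrite EE !mem_ladder_set // => yu yv.
  by have := d_tri y u v; rewrite (d_sym u m) in muv; rewrite (d_sym u y); lia.
have [w [umw vmw uvw]] := median_exists m u v.
have [Ewm|wm] := eqVneq m w; first by rewrite inE; apply/eqP; rewrite Ewm; lia.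
have [y my yw] := geodesic_step e_conn wm.
have : Theta_class [set m; y] \in ladder_set e m u :&: ladder_set e m v.
  rewrite inE !mem_ladder_set //.
  (* Since [w] is between [m] and each of [u], [v], a step from [m] towards [w] shortens both
     distances. *)
  by have := (d_tri w y u, d_tri w y v) => -[]; lia.
by rewrite disj inE.
Qed.

End MedianGraph.

Theorem theorem7 (T : finType) (e : rel T) (v0 : T) (hG : median_graph e)
  (m : T) (L Lstar : {set {set {set T}}})
  (hL : is_POF e L) (hLout : outgoing e v0 m L)
  (hLstar : is_POF e Lstar) (hLstarout : outgoing e v0 m Lstar)
  (u v : T)
  (hmu : m \in interval e v0 u) (hmv : m \in interval e v0 v)
  (hLu : ladder_set e m u = L) (hLv : ladder_set e m v = Lstar) :
  m \in interval e u v <-> L :&: Lstar = set0.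
Proof. by rewrite -hLu -hLv; apply: mem_interval_ladder. Qed.
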